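(* Let $t \in \mathbb{N}$ and let $k$ be an integer with $k \ge 5490 + 45t$. Let $G$ be a finite graph that contains none of the cycles $C_3, C_5, \dots, C_{2k-1}$ as a subgraph (i.e. $G$ has no odd cycle of length less than $2k+1$), and suppose that the minimum degree of $G$ is at least $\frac{1}{2k+t}|V(G)|$. Then $G$ is $3$-colourable. Equivalently, for all such $k$, $\delta_{\chi}(\mathcal{C}_{2k-1},3)\le \frac{1}{2k+t}$.
   Context: $\mathcal{C}_{2k-1}=\{C_3,C_5,\dots,C_{2k-1}\}$ denotes the family of odd cycles of length at most $2k-1$. For a finite family $\mathcal{H}$ of graphs and an integer $c\ge 2$, $\delta_\chi(\mathcal{H},c)$ is the infimum of all $\alpha\in[0,1]$ such that every graph $G$ containing no member of $\mathcal{H}$ as a subgraph and with minimum degree at least $\alpha|V(G)|$ satisfies $\chi(G)\le c$. *)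

(* Defs.v *)
From mathcomp Require Import all_boot.
Set Implicit Arguments. Unset Strict Implicit. Unset Printing Implicit Defensive.

Definition simple_graph (T : finType) (e : rel T) : Prop :=
  symmetric e /\ irreflexive e.

Definition has_cycle (T : finType) (e : rel T) (l : nat) : Prop :=
  2 < l /\
  exists f : 'I_l -> T, injective f /\
    forall i : 'I_l, e (f i) (f (ordS i)).

Definition no_short_odd_cycle (T : finType) (e : rel T) (k : nat) : Prop :=
  forall l : nat, odd l -> 3 <= l -> l <= 2 * k - 1 -> ~ has_cycle e l.

Definition deg (T : finType) (e : rel T) (v : T) : nat := #|[set w | e v w]|.

Definition colourable (T : finType) (e : rel T) (c : nat) : Prop :=
  exists col : T -> 'I_c, forall x y, e x y -> col x != col y.

(* Main.v *)
Require Import Defs.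
From mathcomp Require Import all_boot zify.

(** A maximal set X of vertices with pairwise disjoint neighbourhoods has at most
    2k + t elements, and every vertex is joined to X by a walk of length 2. Sending
    each vertex to such an element of X is a homomorphism onto a graph H on X;
    an edge of H comes from a walk of length 5 in G, so H has no odd closed walk of
    length at most (2k - 1) / 5. In H, exponential growth of balls forces each ball
    to stop growing (its next sphere is at most 1/60 of it) while it is still
    bipartite; deleting these spheres, a set Z with 60 |Z| <= |X|, leaves a bipartite
    graph. The 2-neighbourhood of Z is bipartite too, because its components have
    radius at most 5 |Z|. The two 2-colourings are then merged with a third colour. *)

Set Implicit Arguments. Unset Strict Implicit. Unset Printing Implicit Defensive.

(** * Walks, parity colourings and odd closed walks *)

Section Walks.
Variables (T : finType) (e : rel T).

Definition walk n x y := [exists p : n.-tuple T, path e x p && (last x p == y)].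

Definition within n x y := [exists d : 'I_n.+1, walk d x y].

Definition no_odd_closed_walk m :=
  forall n x, odd n -> n <= m -> ~~ walk n x x.

Lemma walkP n x y :
  reflect (exists p, [/\ path e x p, size p = n & last x p = y]) (walk n x y).
Proof.
apply: (iffP existsP) => [[p /andP[pp /eqP lp]]|[p [pp sp lp]]].
  by exists p; rewrite size_tuple.
by case: _ / sp; exists (in_tuple p); rewrite /= pp lp eqxx.
Qed.

Lemma withinP n x y : reflect (exists2 d, d <= n & walk d x y) (within n x y).
Proof.
apply: (iffP existsP) => [[d wd]|[d le_dn wd]].
  by exists d => //; rewrite -ltnS.
by rewrite -ltnS in le_dn; exists (Ordinal le_dn).
Qed.

Lemma walk0 x : walk 0 x x.
Proof. by apply/walkP; exists [::]. Qed.

Lemma walk1 x y : e x y -> walk 1 x y.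
Proof. by move=> exy; apply/walkP; exists [:: y]; rewrite /= exy. Qed.

Lemma walk_cat m n x y z : walk m x y -> walk n y z -> walk (m + n) x z.
Proof.
case/walkP=> p [pp sp lp] /walkP[q [pq sq lq]]; apply/walkP; exists (p ++ q).
by rewrite cat_path size_cat last_cat lp pp sp sq.
Qed.

Lemma walk_sym n x y : symmetric e -> walk n x y -> walk n y x.
Proof.
move=> sym_e /walkP[p [pp sp lp]]; apply/walkP; exists (rev (belast x p)).
rewrite -lp rev_path size_rev size_belast; split=> //.
  by rewrite (eq_path (e' := e)) // => a b; rewrite sym_e.
by case: (p) => //= a q; rewrite rev_cons last_rcons.
Qed.

Lemma within_refl n x : within n x x.
Proof. by apply/withinP; exists 0; rewrite ?walk0. Qed.

Lemma within_leq m n x y : m <= n -> within m x y -> within n x y.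
Proof.
move=> le_mn /withinP[d le_dm wd]; apply/withinP.
by exists d => //; apply: leq_trans le_mn.
Qed.

Lemma within1 x y : e x y -> within 1 x y.
Proof. by move=> exy; apply/withinP; exists 1; rewrite ?walk1. Qed.

Lemma within_cat m n x y z :
  within m x y -> within n y z -> within (m + n) x z.
Proof.
case/withinP=> a le_a wa /withinP[b le_b wb]; apply/withinP.
by exists (a + b); [apply: leq_add | apply: walk_cat wb].
Qed.

Lemma within_sym n x y : symmetric e -> within n x y -> within n y x.
Proof.
by move=> sym_e /withinP[d le_d wd]; apply/withinP; exists d => //; apply: walk_sym.
Qed.

Lemma no_odd_closed_walk_leq m n :
  n <= m -> no_odd_closed_walk m -> no_odd_closed_walk n.
Proof. by move=> le_nm now l x ol le_ln; apply: now => //; apply: leq_trans le_nm. Qed.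

(** Walks of equal parity from a common root to the two ends of an edge would close up to an odd
    closed walk of length at most [2 * D + 1]. Hence the parity of a short walk from the root is a
    proper colouring. *)
Lemma two_colouring_of_roots (S : {set T}) (rho : T -> T) D :
    symmetric e -> no_odd_closed_walk (2 * D + 1) ->
    {in S, forall x, within D (rho x) x} ->
    {in S &, forall x y, e x y -> rho x = rho y} ->
  exists col : T -> bool, {in S &, forall x y, e x y -> col x != col y}.
Proof.
move=> sym_e now near_rho rho_edge.
exists (fun x => [exists d : 'I_D.+1, odd d && walk d (rho x) x]).
move=> x y Sx Sy exy; have rxy := rho_edge _ _ Sx Sy exy.
have opp i j : i <= D -> j <= D -> walk i (rho x) x -> walk j (rho x) y ->
    odd i != odd j.
  move=> le_i le_j wi wj; apply/negP => /eqP oij.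
  have := walk_cat (walk_cat wi (walk1 exy)) (walk_sym sym_e wj).
  apply/negP/now; first by rewrite !oddD oij addbT addNb addbb.
  lia.
have /withinP[i le_i wi] := near_rho _ Sx.
have /withinP[j le_j wj] := near_rho _ Sy; rewrite -rxy in wj.
have lt_i : i < D.+1 by [].
have lt_j : j < D.+1 by [].
have colE z l (le_l : l < D.+1) : walk l (rho x) z ->
    (forall d, d <= D -> walk d (rho x) z -> odd d = odd l) ->
    [exists d : 'I_D.+1, odd d && walk d (rho x) z] = odd l.
  move=> wl same; apply/existsP/idP => [[d /andP[od wd]]|ol].
    by rewrite -(same d) // -ltnS.
  by exists (Ordinal le_l); rewrite ol.
(* The parity is unambiguous at each end of the edge, being opposite to that of one fixed walk to
   the other end. *)
rewrite -rxy (colE x i) // ?(colE y j) //.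
- exact: opp.
- move=> d le_d wd; have := opp _ _ le_i le_d wi wd.
  by have := opp _ _ le_i le_j wi wj; do 3!case: (odd _).
move=> d le_d wd; have := opp _ _ le_d le_j wd wj.
by have := opp _ _ le_i le_j wi wj; do 3!case: (odd _).
Qed.

(** A repeated vertex splits a closed walk into two shorter ones whose lengths have an odd sum; the
    odd one is kept. *)
Lemma odd_cycle_shorten s : cycle e s -> odd (size s) ->
  exists s', [/\ ucycle e s', odd (size s') & size s' <= size s].
Proof.
have [n le_n] := ubnP (size s); elim: n s le_n => // n IHn s le_n cs os.
have [us|] := boolP (uniq s); first by exists s; rewrite /ucycle cs us.
have [x0 _] : exists x0 : T, true by case: (s) os => // x; exists x.
case/(uniqPn x0)=> i [j [lt_ij lt_js eq_ij]].
have lt_is := ltn_trans lt_ij lt_js.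
have [x [a [b [cab sab]]]] : exists x a b,
    cycle e (x :: a ++ x :: b) /\ (size a + size b).+2 = size s.
  (* After rotation to the repeated vertex, [a] is the stretch between its two occurrences and [b]
     wraps around the end of [s]. *)
  exists (nth x0 s i), (take (j - i.+1) (drop i.+1 s)), (drop j.+1 s ++ take i s).
  have rotE : rot i s = nth x0 s i :: take (j - i.+1) (drop i.+1 s) ++
      nth x0 s i :: (drop j.+1 s ++ take i s).
    rewrite /rot (drop_nth x0) // cat_cons; congr (_ :: _).
    rewrite -cat_cons catA; congr (_ ++ _).
    rewrite -[LHS](cat_take_drop (j - i.+1)) drop_drop subnK //.
    by rewrite (drop_nth x0 lt_js) -eq_ij.
  by rewrite -rotE rot_cycle -(size_rot i s) rotE /= [in RHS]size_cat /= addnS.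
move: cab; rewrite /= rcons_cat cat_path /= => /and3P[pa ea pb].
have ca : cycle e (x :: a) by rewrite /= rcons_path pa.
have [oa|ea'] := boolP (odd (size (x :: a))).
  have [|s' [us' os' le_s']] := IHn _ _ ca oa; first by rewrite /=; lia.
  by exists s'; split=> //; apply: leq_trans le_s' _; rewrite /=; lia.
have ob : odd (size (x :: b)).
  by move: ea' os; rewrite /= -sab /= oddD !negbK => ->.
have [|s' [us' os' le_s']] := IHn (x :: b) _ pb ob; first by rewrite /=; lia.
by exists s'; split=> //; apply: leq_trans le_s' _; rewrite /=; lia.
Qed.

Lemma ucycle_has_cycle s : ucycle e s -> 2 < size s -> has_cycle e (size s).
Proof.
case/andP=> cs us lt2s; split=> //.
have [x0 _] : exists x0 : T, true by case: (s) lt2s => // x; exists x.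
exists (fun i => nth x0 s i); split=> [i j /eqP|i].
  by rewrite nth_uniq // => /eqP/val_inj.
case: s cs {us lt2s} i => [_ []//|x s]; rewrite [cycle e _]/= => ps i.
have := pathP x0 ps i; rewrite size_rcons => /(_ (ltn_ord i)).
have lt_i : i < (size s).+1 := ltn_ord i.
rewrite nth_rcons -rcons_cons nth_rcons /= lt_i.
case: (ltngtP i (size s)) => [lt_is | lt_is | eq_is].
- by rewrite modn_small.
- by rewrite ltnS leqNgt lt_is in lt_i.
by rewrite eq_is modnn.
Qed.

Lemma no_odd_closed_walk_of_girth k :
  simple_graph e -> no_short_odd_cycle e k -> no_odd_closed_walk (2 * k - 1).
Proof.
move=> [_ irr_e] hcyc n x on le_n; apply/negP => /walkP[p [pp sp lp]].
(* The start [x] is also the last entry of [p], so [p] alone lists the closed walk cyclically. *)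
have cp : cycle e p.
  case/lastP: p => [//|p y] in pp sp lp *.
  rewrite last_rcons in lp; rewrite lp in pp.
  by rewrite lp -(rot_cycle (size p)) -cats1 rot_size_cat.
have [|s [us os le_s]] := odd_cycle_shorten cp; first by rewrite sp.
have lt2s : 2 < size s.
  case: s us os {le_s} => [|a [|b [|c s]]] //=; first by rewrite /ucycle /= irr_e.
apply: (hcyc (size s)) => //; last exact: ucycle_has_cycle.
by rewrite (leq_trans le_s) // sp.
Qed.

End Walks.

(** * Slowly growing balls and a small separator *)

Section SmallSeparator.
Variables (T : finType) (e : rel T) (c R : nat).
Hypothesis sym_e : symmetric e.
Hypothesis now : no_odd_closed_walk e (2 * R + 1).
Hypothesis growth : #|T| * c ^ R.+1 < c.+1 ^ R.+1.

(** Balls grow only inside [U], so that the construction can be repeated after deletions. *)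
Let ball (U : {set T}) v := fix ball r : {set T} :=
  if r is r'.+1 then ball r' :|: [set y in U | [exists x in ball r', e x y]]
  else [set v].

Let ball_within U v r x : x \in ball U v r -> within e r v x.
Proof.
elim: r x => [|r IHr] x /=; first by rewrite inE => /eqP->; apply: within_refl.
rewrite !inE => /orP[/IHr|/andP[_ /existsP[y /andP[/IHr wy eyx]]]].
  exact: within_leq.
by rewrite -addn1; apply: within_cat wy (within1 eyx).
Qed.

Let ball_centre U v r : v \in ball U v r.
Proof. by elim: r => [|r IHr]; rewrite inE // IHr. Qed.

Let ball_sub (U : {set T}) v r : v \in U -> ball U v r \subset U.
Proof.
move=> Uv; elim: r => [|r IHr] /=; first by rewrite sub1set.
by rewrite subUset IHr; apply/subsetP => x; rewrite inE => /andP[].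
Qed.

(** Otherwise each of the [R.+1] steps multiplies the ball by more than (c + 1) / c, and by [growth]
    it would outgrow [T]. *)
Let slow_ball U v : exists2 r, r <= R &
  c * #|ball U v r.+1 :\: ball U v r| <= #|ball U v r|.
Proof.
pose slow (r : 'I_R.+1) := c * #|ball U v r.+1 :\: ball U v r| <= #|ball U v r|.
have [/existsP[r slow_r]|/existsPn fast] := boolP [exists r, slow r].
  by exists r => //; rewrite -ltnS.
have grow r : r <= R.+1 -> c.+1 ^ r <= #|ball U v r| * c ^ r.
  elim: r => [|r IHr] lt_r; first by rewrite cards1.
  have := fast (Ordinal lt_r); rewrite /slow -ltnNge [_ (Ordinal _)]/= => fast_r.
  have sub : ball U v r \subset ball U v r.+1 by apply: subsetUl.
  have := cardsID (ball U v r) (ball U v r.+1); rewrite (setIidPr sub).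
  move: fast_r (IHr (ltnW lt_r)); rewrite !expnS.
  move: #|_ :\: _| #|ball U v r| #|ball U v r.+1| (c ^ r) (c.+1 ^ r) => l b b' x y.
  by move=> fast_r le_y <-; nia.
have := grow _ (leqnn _); rewrite leqNgt => /negP[].
by apply: leq_ltn_trans growth; rewrite leq_mul2r max_card orbT.
Qed.

(** Each deleted sphere is charged to the ball inside it. These balls are disjoint, which gives
    [c * #|Z| <= #|T|]. *)
Lemma small_bipartite_separator :
  exists (Z : {set T}) (col : T -> bool), c * #|Z| <= #|T| /\
    {in ~: Z &, forall x y, e x y -> col x != col y}.
Proof.
suff [Z [col [le_Z colP]]] : exists (Z : {set T}) (col : T -> bool),
    c * #|Z| <= #|[set: T]| /\
    {in [set: T] :\: Z &, forall x y, e x y -> col x != col y}.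
  by exists Z, col; rewrite -cardsT -setTD.
(* Cut out a slowly growing ball together with its next sphere, and recurse on
   what remains of U. *)
move: [set: T] => U; have [n le_n] := ubnP #|U|.
elim: n U le_n => // n IHn U le_n.
have [->|[v Uv]] := set_0Vmem U.
  exists set0, (fun=> true); rewrite !cards0 muln0; split=> // x y.
  by rewrite !inE.
have [r le_r slow_r] := slow_ball U v.
set B := ball U v r in slow_r; set B' := ball U v r.+1 in slow_r.
have subB : B \subset B' by apply: subsetUl.
have subB'U : B' \subset U by apply: ball_sub.
have Bv : v \in B by apply: ball_centre.
have cardU := cardsID B' U; rewrite (setIidPr subB'U) in cardU.
have cardB' := cardsID B B'; rewrite (setIidPr subB) in cardB'.
have B_gt0 : 0 < #|B| by rewrite card_gt0; apply/set0Pn; exists v.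
have [|Z [col [le_Z colP]]] := IHn (U :\: B'); first by lia.
have [col' col'P] : exists col' : T -> bool,
    {in B &, forall x y, e x y -> col' x != col' y}.
  apply: (two_colouring_of_roots (rho := fun=> v) (D := r)) => //.
    by apply: no_odd_closed_walk_leq now; lia.
  by move=> x; apply: ball_within.
exists (Z :|: (B' :\: B)), (fun x => if x \in B then col' x else col x); split.
  apply: leq_trans (leq_mul (leqnn c) (leq_card_setU Z (B' :\: B))) _.
  by rewrite mulnDr; lia.
(* Deleting the sphere [B' :\: B] thus leaves no edge between [B] and the rest of [U], so the two
   colourings are independent. *)
have BB' x y : x \in B -> y \in U -> e x y -> y \in B'.
  move=> Bx Uy exy; rewrite !inE Uy /=; apply/orP; right.
  by apply/existsP; exists x; rewrite Bx.
move=> x y; rewrite !in_setD !(in_setU _ Z) !in_setD !negb_or !negb_and !negbK.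
case/andP=> /andP[Zx Lx] Ux /andP[/andP[Zy Ly] Uy] exy.
have [Bx|nBx] := boolP (x \in B); have [By|nBy] := boolP (y \in B).
- exact: col'P.
- by move: Ly; rewrite (negPf nBy) (BB' x).
- by move: Lx; rewrite (negPf nBx) (BB' y) // sym_e.
apply: colP => //; rewrite !in_setD.
  by move: Lx; rewrite (negPf nBx) /= => ->; rewrite Zx Ux.
by move: Ly; rewrite (negPf nBy) /= => ->; rewrite Zy Uy.
Qed.

End SmallSeparator.

(** * Merging a colouring near [Z] with one off [Z] *)

Section Gluing.
Variables (T : finType) (e : rel T).
Hypothesis sym_e : symmetric e.

Definition neighbourhood (Z : {set T}) r := [set x | [exists z in Z, within e r z x]].

Lemma neighbourhoodP (Z : {set T}) r x :
  reflect (exists2 z, z \in Z & within e r z x) (x \in neighbourhood Z r).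
Proof. by rewrite inE; apply: exists_inP. Qed.

Lemma neighbourhood_edge (Z : {set T}) r x y :
  e x y -> x \in neighbourhood Z r -> y \in neighbourhood Z r.+1.
Proof.
move=> exy /neighbourhoodP[z Zz wzx]; apply/neighbourhoodP; exists z => //.
by rewrite -addn1; apply: within_cat wzx (within1 exy).
Qed.

Lemma neighbourhoodS (Z : {set T}) r x :
  x \in neighbourhood Z r -> x \in neighbourhood Z r.+1.
Proof.
case/neighbourhoodP=> z Zz wzx; apply/neighbourhoodP; exists z => //.
exact: within_leq wzx.
Qed.

(* The vertices of Z at distance at most 5 from each other form clusters; a
   chain inside Z has fewer than #|Z| links, so each component of the
   2-neighbourhood of Z has radius at most 5 #|Z|. *)
Lemma neighbourhood_bipartite (Z : {set T}) :
    no_odd_closed_walk e (10 * #|Z| + 1) ->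
  exists col : T -> bool,
    {in neighbourhood Z 2 &, forall x y, e x y -> col x != col y}.
Proof.
move=> now.
pose link x y := [&& x \in Z, y \in Z & within e 5 x y].
have sym_link : connect_sym link.
  apply: sym_connect_sym => x y; rewrite /link andbCA.
  by congr [&& _, _ & _]; apply/idP/idP; apply: within_sym.
have link_path x p : path link x p ->
    within e (5 * size p) x (last x p) /\ {subset p <= Z}.
  elim: p x => [|y p IHp] x /=; first by rewrite within_refl.
  case/andP=> /and3P[Zx Zy wxy] /IHp[wp subp]; split.
    by rewrite mulnS; apply: within_cat wxy wp.
  by move=> z; rewrite inE => /predU1P[->|/subp].
have link_within x y : x \in Z -> connect link x y -> within e (5 * #|Z| - 5) x y.
  move=> Zx /connectP[p0 pp0 ->]; case/shortenP: pp0 => p pp up _.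
  have [wp subp] := link_path _ _ pp; apply: within_leq wp.
  have : size (x :: p) <= #|Z|.
    rewrite -(card_uniqP up); apply/subset_leq_card/subsetP => z.
    by rewrite inE => /predU1P[->|/subp].
  by rewrite /=; lia.
have /fin_all_exists[f fP] x :
    exists z, x \in neighbourhood Z 2 -> z \in Z /\ within e 2 z x.
  have [/neighbourhoodP[z Zz wz]|_] := boolP (x \in neighbourhood Z 2).
    by exists z.
  by exists x.
apply: (two_colouring_of_roots (rho := root link \o f) (D := 5 * #|Z|)) => //.
- by apply: no_odd_closed_walk_leq now; lia.
- move=> x /fP[Zf wf] /=.
  (* With [Z] nonempty the subtraction in [5 * #|Z| - 5] is not truncated, which leaves room for the
     2 further steps to [x]. *)
  have Z_gt0 : 0 < #|Z| by rewrite card_gt0; apply/set0Pn; exists (f x).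
  have wr := link_within _ _ Zf (connect_root link (f x)).
  by apply: within_leq (within_cat (within_sym sym_e wr) wf); lia.
(* Adjacent vertices have their chosen elements of [Z] within 2 + 1 + 2 = 5 steps, the threshold in
   [link]. *)
move=> x y /fP[Zx wx] /fP[Zy wy] exy /=; apply/eqP; rewrite root_connect //.
apply: connect1; rewrite /link Zx Zy.
exact: (within_cat (within_cat wx (within1 exy)) (within_sym sym_e wy)).
Qed.

(* Where the 2-colourings c1 near Z and c2 off Z disagree, the pair of colours
   given to c1 = false, true runs through (0,1), (2,1), (2,0), (1,0) as the
   distance to Z grows from 0 to 3: c1 is turned into c2. *)
Lemma glue_two_colourings (Z : {set T}) (c1 c2 : T -> bool) :
    {in neighbourhood Z 2 &, forall x y, e x y -> c1 x != c1 y} ->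
    {in ~: Z &, forall x y, e x y -> c2 x != c2 y} ->
  colourable e 3.
Proof.
move=> c1P c2P; pose N := neighbourhood Z.
pose i0 : 'I_3 := inord 0; pose i1 : 'I_3 := inord 1; pose i2 : 'I_3 := inord 2.
pose col x := if x \in Z then (if c1 x then i1 else i0)
  else if (x \notin N 2) || (c1 x == c2 x) then (if c2 x then i1 else i0)
  else if x \in N 1 then (if c1 x then i1 else i2)
  else (if c1 x then i0 else i2).
have ne : [&& i0 != i1, i1 != i0, i0 != i2, i2 != i0, i1 != i2 & i2 != i1].
  by rewrite -!val_eqE /= !inordK.
exists col => x y exy; have eyx : e y x by rewrite sym_e.
have ZN z : z \in Z -> z \in N 0.
  by move=> Zz; apply/neighbourhoodP; exists z; rewrite ?within_refl.
have c1xy : x \in N 2 -> y \in N 2 -> c1 x != c1 y.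
  by move=> Nx Ny; apply: c1P.
have c2xy : x \notin Z -> y \notin Z -> c2 x != c2 y.
  by move=> Zx Zy; apply: c2P; rewrite ?inE.
have Zx1 : x \in Z -> y \in N 1 by move/ZN; apply: neighbourhood_edge.
have Zy1 : y \in Z -> x \in N 1 by move/ZN; apply: neighbourhood_edge.
have Zx2 : x \in Z -> x \in N 1 by move/ZN; apply: neighbourhoodS.
have Zy2 : y \in Z -> y \in N 1 by move/ZN; apply: neighbourhoodS.
have Nx1 : x \in N 1 -> y \in N 2 by apply: neighbourhood_edge.
have Ny1 : y \in N 1 -> x \in N 2 by apply: neighbourhood_edge.
have Nx2 : x \in N 1 -> x \in N 2 by apply: neighbourhoodS.
have Ny2 : y \in N 1 -> y \in N 2 by apply: neighbourhoodS.
case/and5P: ne => n01 n10 n02 n20 /andP[n12 n21].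
(* What remains is a finite check over the memberships and colours of [x] and [y]. *)
move: c1xy c2xy Zx1 Zy1 Zx2 Zy2 Nx1 Ny1 Nx2 Ny2; rewrite /col {col ZN}.
move: (x \in Z) (y \in Z) (x \in N 1) (y \in N 1) (x \in N 2) (y \in N 2).
move=> [] [] [] [] [] [] c1xy c2xy; do 8!move=> /implyP //= _;
  move: c1xy c2xy; move: (c1 x) (c1 y) (c2 x) (c2 y) => [] [] [] [] //=;
  by do ?[move=> /(_ isT) // | move=> _ //=].
Qed.

End Gluing.

(** * Growth estimates and the choice of constants *)

(** For positive [c] this is Bernoulli's inequality (1 + 1/c)^n >= 1 + n/c with denominators
    cleared. *)
Lemma bernoulli_expn c n : c ^ n * (c + n) <= c * c.+1 ^ n.
Proof.
elim: n => [|n IHn]; first by rewrite !expn0 mul1n muln1 addn0.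
rewrite !expnS; move: (c ^ n) (c.+1 ^ n) IHn => x y IHn; nia.
Qed.

(** Bernoulli with [n = c] gives (1 + 1/c)^c >= 2; then take the power [q]. *)
Lemma double_expn c q : 0 < c -> 2 ^ q * c ^ (c * q) <= c.+1 ^ (c * q).
Proof.
move=> c_gt0; rewrite !expnM -expnMn; case: q => // q; rewrite leq_exp2r //.
have := bernoulli_expn c c; rewrite addnn -muln2 mulnCA leq_pmul2l //.
by rewrite mulnC.
Qed.

Lemma linear_lt_growth c q r N :
  0 < c -> N < 2 ^ q -> N * c ^ (c * q + r) < c.+1 ^ (c * q + r).
Proof.
move=> c_gt0 lt_N; rewrite !expnD.
have le_r : c ^ r <= c.+1 ^ r by case: (r) => // r'; rewrite leq_exp2r.
apply: leq_trans (leq_mul (double_expn q c_gt0) le_r).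
by rewrite -mulnA ltn_pmul2r // muln_gt0 !expn_gt0 c_gt0.
Qed.

Lemma linear_lt_exp2 q : 18 <= q -> 900 * q.+1 <= 2 ^ q.
Proof.
elim: q => // q IHq; rewrite leq_eqVlt => /predU1P[<-|]; first by rewrite (expnD 2 9 9).
by rewrite ltnS => /IHq; rewrite expnS; lia.
Qed.

Lemma growth_bound k N : 5 * 60 * 18 <= k -> N <= 3 * k ->
  N * 60 ^ (k %/ 5) < 61 ^ (k %/ 5).
Proof.
(* Here k < 300 (q + 1), so N <= 3k < 900 (q + 1), and k >= 5400 gives q >= 18. *)
move=> le_k le_N; pose q := k %/ 5 %/ 60.
have -> : k %/ 5 = 60 * q + k %/ 5 %% 60 by rewrite mulnC -divn_eq.
apply: linear_lt_growth => //; apply: leq_trans (linear_lt_exp2 _); rewrite /q; lia.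
Qed.

(** With 60 |Z| <= |T|, the bound on |T| gives 50 |Z| <= 2k - 26, so closed walks of odd length up
    to 10 |Z| + 1 are excluded. The radius [(k %/ 5).-1] satisfies 5 (2R + 1) <= 2k - 5. *)
Lemma three_colourable_of_odd_girth (T : finType) (e : rel T) k :
    symmetric e -> 5 * 60 * 18 <= k -> 5 * #|T| + 156 <= 12 * k ->
    (forall n x, odd n -> 5 * n <= 2 * k - 1 -> ~~ walk e n x x) ->
  colourable e 3.
Proof.
move=> sym_e le_k le_T now.
have nowm m : 5 * m <= 2 * k - 1 -> no_odd_closed_walk e m.
  by move=> le_m n x on le_n; apply: now => //; lia.
have [|| Z [c2 [le_Z c2P]]] := @small_bipartite_separator T e 60 (k %/ 5).-1 sym_e.
- by apply: nowm; lia.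
- by rewrite prednK ?growth_bound //; lia.
have [|c1 c1P] := @neighbourhood_bipartite T e sym_e Z.
  by apply: nowm; lia.
exact: glue_two_colourings c1P c2P.
Qed.

(** * Contraction onto a maximal set with disjoint neighbourhoods *)

Section Reduction.
Variables (T : finType) (e : rel T).
Hypothesis sym_e : symmetric e.

Let disjoint_nbhds (X : {set T}) :=
  [forall x in X, forall y in X, forall w, e x w && e y w ==> (x == y)].

Let disjoint_nbhdsP (X : {set T}) :
  reflect {in X &, forall x y w, e x w -> e y w -> x = y} (disjoint_nbhds X).
Proof.
apply: (iffP idP) => [dX x y Xx Xy w exw eyw|dX].
  move/forall_inP/(_ x Xx)/forall_inP/(_ y Xy)/forallP/(_ w): dX.
  by rewrite exw eyw => /eqP.
apply/forall_inP => x Xx; apply/forall_inP => y Xy; apply/forallP => w.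
by apply/implyP => /andP[exw eyw]; apply/eqP; apply: dX exw eyw.
Qed.

(** Double counting: every [w] is adjacent to at most one element of [X], so the degrees over [X]
    sum to at most [#|T|]. *)
Lemma disjoint_nbhds_card (X : {set T}) d :
    {in X &, forall x y w, e x w -> e y w -> x = y} ->
    (forall v, #|T| <= d * deg e v) -> 0 < #|T| ->
  #|X| <= d.
Proof.
move=> dX hdeg T_gt0; rewrite -(leq_pmul2r T_gt0).
have sum_deg : \sum_(x in X) deg e x <= #|T|.
  have degE x : deg e x = \sum_w e x w.
    rewrite /deg -sum1_card big_mkcond; apply: eq_bigr => w _.
    by rewrite inE; case: (e x w).
  under eq_bigr do rewrite degE.
  rewrite exchange_big /= -sum1_card; apply: leq_sum => w _.
  have [x /andP[Xx exw]|no] := pickP [pred x in X | e x w].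
    rewrite (bigD1 x) //= exw big1 // => y /andP[Xy yx].
    by case eyw: (e y w) => //; case/eqP: yx; apply: dX eyw exw.
  by rewrite big1 // => x Xx; have := no x; rewrite /= Xx /= => ->.
apply: leq_trans (_ : d * \sum_(x in X) deg e x <= _); last first.
  by rewrite leq_mul2l sum_deg orbT.
by rewrite big_distrr /= -sum_nat_const; apply: leq_sum.
Qed.

(** A vertex of [X] returns to itself through a neighbour; a vertex outside with no 2-walk to [X]
    could be added to [X]. *)
Lemma maximal_disjoint_nbhds :
    (forall v, 0 < deg e v) ->
  exists X : {set T}, {in X &, forall x y w, e x w -> e y w -> x = y} /\
    forall v, exists2 x, x \in X & walk e 2 v x.
Proof.
move=> deg_gt0; have [|X /maxsetP[dX maxX]] := @ex_maxset T disjoint_nbhds.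
  by exists set0; apply/disjoint_nbhdsP => x y; rewrite inE.
have {}dX := disjoint_nbhdsP _ dX; exists X; split=> // v.
have nbr x y w : e x w -> e y w -> walk e 2 x y.
  by move=> exw eyw; apply: (walk_cat (walk1 exw)); apply: walk1; rewrite sym_e.
have [Xv|nXv] := boolP (v \in X).
  have := deg_gt0 v; rewrite card_gt0 => /set0Pn[w]; rewrite inE => evw.
  by exists v => //; apply: (nbr v v w).
have [/exists_inP[x Xx wx]|/exists_inPn far] := boolP [exists x in X, walk e 2 v x].
  by exists x.
case/negP: nXv; rewrite -(maxX (v |: X)) ?setU11 ?subsetUr //.
apply/disjoint_nbhdsP => x y; rewrite !inE.
case/predU1P=> [->|Xx] /predU1P[->|Xy] w exw eyw //; last exact: dX exw eyw.
- by case/negP: (far _ Xy); apply: nbr exw eyw.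
by case/negP: (far _ Xx); apply: nbr eyw exw.
Qed.

Variables (V : finType) (g : V -> T) (f : T -> V).
Hypothesis near_f : forall v, walk e 2 v (g (f v)).

(** Loops are allowed here; a later bound on odd closed walks excludes them as closed walks of
    length 1. *)
Definition contract : rel V :=
  fun a b => [exists x, exists y, [&& e x y, f x == a & f y == b]].

Lemma contract_edge x y : e x y -> contract (f x) (f y).
Proof.
move=> exy; apply/existsP; exists x; apply/existsP; exists y.
by rewrite exy !eqxx.
Qed.

Lemma contract_sym : symmetric contract.
Proof.
by move=> a b; apply/idP/idP => /existsP[x /existsP[y /and3P[exy /eqP<- /eqP<-]]];
  apply: contract_edge; rewrite sym_e.
Qed.

(** An edge coming from [e x y] lifts to a walk from [g (f x)] through [x] and [y] to [g (f y)], of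
    length 2 + 1 + 2. *)
Lemma contract_walk n a b : walk contract n a b -> walk e (5 * n) (g a) (g b).
Proof.
case/walkP=> p [pp <- <-]; elim: p a pp => [|c p IHp] a /=.
  by rewrite walk0.
case/andP=> /existsP[x /existsP[y /and3P[exy /eqP<- /eqP<-]]] /IHp wp.
rewrite mulnS; apply: walk_cat wp.
exact: (walk_cat (walk_cat (walk_sym sym_e (near_f x)) (walk1 exy)) (near_f y)).
Qed.

End Reduction.

(* min degree >= |V|/(2k+t) is stated exactly in nat as (2k+t)*deg v >= |V|. *)
Theorem theorem1p1 (t k : nat) (hk : 5490 + 45 * t <= k)
  (T : finType) (e : rel T) (hG : simple_graph e)
  (hcyc : no_short_odd_cycle e k)
  (hdeg : forall v : T, #|T| <= (2 * k + t) * deg e v) :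
  colourable e 3.
Proof.
have [sym_e _] := hG.
have {hk} le_k : 5 * 60 * 18 + 45 * t <= k.
  by apply: leq_trans hk; rewrite leq_add2r.
have [/card0_eq T0|T_gt0] := posnP #|T|.
  by exists (fun=> ord0) => x; have := T0 x.
have deg_gt0 v : 0 < deg e v.
  by have := leq_trans T_gt0 (hdeg v); rewrite muln_gt0 => /andP[].
have [X [dX nearX]] := maximal_disjoint_nbhds sym_e deg_gt0.
have le_X := disjoint_nbhds_card dX hdeg T_gt0.
have /fin_all_exists[f near_f] v : exists a : {x | x \in X}, walk e 2 v (val a).
  by have [x Xx wx] := nearX v; exists (Sub x Xx).
have now := no_odd_closed_walk_of_girth hG hcyc.
have [|||col colP] :=
  @three_colourable_of_odd_girth _ (contract e f) k (contract_sym sym_e f).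
- by lia.
(* As |X| <= 2k + t, it suffices that 5t + 156 <= 2k, which [le_k] gives. *)
- by rewrite card_sig (eq_card (B := X)) //; lia.
- move=> n a on le_n; apply/negP => /(contract_walk sym_e near_f).
  by apply/negP/now; rewrite ?oddM.
by exists (col \o f) => x y exy; apply/colP/contract_edge.
Qed.
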